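(* Let $X_1,\dots,X_n$ be random variables whose joint cdf is absolutely continuous with respect to the product of their one-dimensional marginal cdf's, and let $\xi_1,\dots,\xi_n$ be independent random variables such that $\xi_k$ has the same distribution as $X_k$, $k=1,\dots,n$. Then for an arbitrary statistic $h(X_1,\dots,X_n)$ ($h:\mathbf R^n\to\mathbf R$ Borel measurable) and every $x\in\mathbf R$ $$\big|P(h(X_1,\dots,X_n)\le x)-P(h(\xi_1,\dots,\xi_n)\le x)\big|\le\phi_{X_1,\dots,X_n}\max\Big[\big(P(h(\xi_1,\dots,\xi_n)\le x)\big)^{1/2},\big(P(h(\xi_1,\dots,\xi_n)>x)\big)^{1/2}\Big].$$
   Context: Let $F$ be the joint cdf and $F_1,\dots,F_n$ the marginal cdf's of $X_1,\dots,X_n$, and let $G=\frac{dF}{dF_1\cdots dF_n}\ge0$ be the density of the joint distribution with respect to the product of marginals. Then $\phi_{X_1,\dots,X_n}=(\phi^2_{X_1,\dots,X_n})^{1/2}\in[0,\infty]$, where $\phi^2_{X_1,\dots,X_n}=\int_{\mathbf R^n}G^2\prod_{i=1}^ndF_i-1$ is the multivariate Pearson coefficient. *)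

(* Defs.v *)
From HB Require Import structures.
From mathcomp Require Import all_boot all_order all_algebra.
From mathcomp Require Import all_classical all_reals all_analysis.

Set Implicit Arguments.
Unset Strict Implicit.
Unset Printing Implicit Defensive.

Import Order.TTheory GRing.Theory Num.Theory.
Import numFieldNormedType.Exports.

Local Open Scope classical_set_scope.
Local Open Scope ring_scope.
Local Open Scope ereal_scope.

(** Euclidean space is [n.-tuple R] with the product Borel sigma-algebra. *)

Section cons_map.
Context d (T : measurableType d) (n : nat).

Definition cons_map (p : T * n.-tuple T) : n.+1.-tuple T := [tuple of p.1 :: p.2].

Lemma measurable_cons_map : measurable_fun [set: T * n.-tuple T] cons_map.
Proof. exact: measurable_cons. Qed.

HB.instance Definition _ := isMeasurableFun.Build _ _ _ _ cons_map
  measurable_cons_map.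

End cons_map.

(** The product of [n] probability measures, as a measure on [n]-tuples: the
    image of [mu 0 \x (mu 1 \x ...)] under the identification of
    [T * n.-tuple T] with [n.+1.-tuple T]. *)
Fixpoint tuple_probability d (T : measurableType d) (R : realType) (n : nat) :
    ('I_n -> probability T R) -> probability (n.-tuple T) R :=
  match n with
  | 0 => fun=> dirac [tuple]
  | m.+1 => fun mu =>
      distribution (mu ord0 \x tuple_probability (fun i => mu (lift ord0 i)))
        (@cons_map _ T m)
  end.

(** This is the measure determined by its values on boxes. *)
Lemma tuple_probability_box d (T : measurableType d) (R : realType) (n : nat)
    (mu : 'I_n -> probability T R) (A : 'I_n -> set T) :
  (forall i, measurable (A i)) ->
  tuple_probability mu [set t | forall i, A i (tnth t i)] =
  \prod_(i < n) mu i (A i).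
Proof.
elim: n => [|n IH] in mu A *.
  move=> _; rewrite big_ord0 /= diracE mem_set//; by case.
move=> mA; rewrite big_ord_recl -IH//= /distribution /pushforward -product_measure1E//.
  congr (_ _); apply/seteqP; split=> -[x t] /=.
    move=> H; split; first by have := H ord0; rewrite tnth0.
    by move=> i; have := H (lift ord0 i); rewrite tnthS.
  by move=> [Ax At] i; case: (unliftP ord0 i) => [j ->|->];
    rewrite ?tnthS ?tnth0.
rewrite (_ : [set t | _] = \bigcap_(i in [set: 'I_n])
    ((@tnth n T)^~ i @^-1` A (lift ord0 i))); last first.
  by apply/seteqP; split=> t /= H i //=; exact: H.
apply: fin_bigcap_measurable => // i _.
by rewrite -[X in measurable X]setTI; exact: measurable_tnth.
Qed.

Section random_vectors.
Context d (T : measurableType d) (R : realType) (P : probability T R) (n : nat).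
Variable X : 'I_n -> {RV P >-> R}.

Definition random_vector (w : T) : n.-tuple R := [tuple X i w | i < n].

Lemma measurable_random_vector : measurable_fun [set: T] random_vector.
Proof.
apply/measurable_fun_tnthP => i.
rewrite (_ : _ \o _ = X i) //.
by apply/funext => w /=; rewrite tnth_mktuple.
Qed.

HB.instance Definition _ := isMeasurableFun.Build _ _ _ _ random_vector
  measurable_random_vector.

(** The measure [dF]. *)
Definition joint_law : probability (n.-tuple R) R := distribution P random_vector.

(** The measure [dF_1 ... dF_n]. *)
Definition product_of_marginals : probability (n.-tuple R) R :=
  tuple_probability (fun i => distribution P (X i)).

(** [dF / (dF_1 ... dF_n)]; meaningful only when
    [joint_law `<< product_of_marginals], in which case it is finite and
    nonnegative everywhere. *)
Definition joint_density : n.-tuple R -> \bar R :=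
  Radon_Nikodym_SigmaFinite.f joint_law product_of_marginals.

Definition pearson_coef2 : \bar R :=
  (\int[product_of_marginals]_t (joint_density t ^+ 2)) - 1.

Definition pearson_coef : \bar R := sqrte pearson_coef2.

(** Mutual independence: the product rule for every finite subfamily. *)
Definition mutually_independent : Prop :=
  forall (J : {set 'I_n}) (A : 'I_n -> set R),
    (forall i, measurable (A i)) ->
    P (\bigcap_(i in [set` J]) (X i @^-1` A i)) =
    \prod_(i in J) P (X i @^-1` A i).

End random_vectors.

(** Equality of laws is only required on Borel sets, since [distribution] is
    a total function with arbitrary values on the other sets. *)
Definition same_distribution d d' (T : measurableType d)
    (T' : measurableType d') (R : realType) (P : probability T R)
    (P' : probability T' R) (X : {RV P >-> R}) (Y : {RV P' >-> R}) : Prop :=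
  forall A : set R, measurable A -> distribution P X A = distribution P' Y A.

(* Main.v *)
(** Independence makes the law of [xi] the product of the marginals of [X]: the
    two agree on boxes, a generating pi-system. With [mu] this product, [nu] the
    law of [X], [G] its density and [A] the event [h <= x], the Cauchy-Schwarz
    inequality on [A] and on its complement bounds the integrals of [G^2] over
    these two sets from below in terms of [a = mu A] and [b = nu A]; added up,
    they give [(b - a)^2 <= phi^2 * a]. *)

Require Import Defs.
From HB Require Import structures.
From mathcomp Require Import all_boot all_order all_algebra.
From mathcomp Require Import all_classical all_reals all_analysis.
From mathcomp Require Import measurable_realfun ring lra.
Import Order.TTheory GRing.Theory Num.Theory.
Import numFieldNormedType.Exports.
Local Open Scope classical_set_scope.
Local Open Scope ring_scope.
Local Open Scope ereal_scope.

Section tuple_boxes.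
Context {d} {T : measurableType d} {n : nat}.

Definition tuple_box (A : 'I_n -> set T) : set (n.-tuple T) :=
  [set t | forall i, A i (tnth t i)].

Definition measurable_tuple_boxes : set (set (n.-tuple T)) :=
  [set tuple_box A | A in [set A | forall i, measurable (A i)]].

Lemma measurable_tuple_box (A : 'I_n -> set T) :
  (forall i, measurable (A i)) -> measurable (tuple_box A).
Proof.
move=> mA; rewrite (_ : tuple_box A = \bigcap_(i in [set: 'I_n])
    ((@tnth n T)^~ i @^-1` A i)); last first.
  by apply/seteqP; split=> t /= H i //=; exact: H.
apply: fin_bigcap_measurable => // i _.
by rewrite -[X in measurable X]setTI; exact: measurable_tnth.
Qed.

Lemma setI_closed_tuple_boxes : setI_closed measurable_tuple_boxes.
Proof.
move=> _ _ [A mA <-] [B mB <-]; exists (fun i => A i `&` B i).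
  by move=> i; exact: measurableI.
apply/seteqP; split=> t /=; first by move=> H; split=> i; case: (H i).
by move=> [At Bt] i; split; [exact: At|exact: Bt].
Qed.

Lemma tuple_boxes_setT : measurable_tuple_boxes setT.
Proof. by exists (fun=> setT) => //; apply/seteqP; split. Qed.

(** The tuple sigma-algebra is generated by the coordinate preimages. Each of these is a box with
    [setT] on all other sides, and conversely every box is a finite intersection of them. *)
Lemma measurable_tupleE :
  (@measurable _ (n.-tuple T)) = <<s measurable_tuple_boxes >>.
Proof.
apply/seteqP; split.
  apply: smallest_sub; first exact: smallest_sigma_algebra.
  move=> B; rewrite -bigcup_seq => -[i _ [A mA <-]].
  apply: sub_sigma_algebra; exists (fun j => if j == i then A else setT).
    by move=> j; case: ifP.
  apply/seteqP; split=> t /=; first by move=> /(_ i); rewrite eqxx.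
  by move=> [_ At] j; case: eqP => // ->.
apply: smallest_sub; first exact: sigma_algebra_measurable.
by move=> _ [A mA <-]; exact: measurable_tuple_box.
Qed.

(** Uniqueness of measures on a generating pi-system. The whole space is itself a box of finite
    measure, so the constant sequence [setT] serves as the exhaustion. *)
Lemma tuple_probability_unique {R : realType} (mu nu : probability (n.-tuple T) R) :
  (forall A, (forall i, measurable (A i)) ->
    mu (tuple_box A) = nu (tuple_box A)) ->
  forall B, measurable B -> mu B = nu B.
Proof.
move=> munu; apply: (measure_unique measurable_tuple_boxes (fun=> setT)).
- exact: measurable_tupleE.
- exact: setI_closed_tuple_boxes.
- by move=> _; exact: tuple_boxes_setT.
- exact: bigcup_const.
- by move=> _ [A mA <-]; exact: munu.
- by move=> _; rewrite ltey_eq (fin_num_measure mu).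
Qed.

End tuple_boxes.

(** On a box, the product rule for the full index set factors the law of [xi], and equality in
    distribution turns each factor into a marginal of [X]. *)
Lemma joint_law_independent {R : realType} {n d d'} {T : measurableType d}
    {T' : measurableType d'} {P : probability T R} {P' : probability T' R}
    {X : 'I_n -> {RV P >-> R}} {xi : 'I_n -> {RV P' >-> R}} :
  mutually_independent xi ->
  (forall k, same_distribution (xi k) (X k)) ->
  forall B, measurable B -> joint_law xi B = product_of_marginals X B.
Proof.
move=> indep xiX; apply: tuple_probability_unique => A mA.
rewrite [RHS]tuple_probability_box//.
transitivity (\prod_(i in [set: 'I_n]%SET) P' (xi i @^-1` A i)).
  rewrite -indep//; congr (P' _); apply/seteqP; split=> w /=.
    by move=> H i _; have := H i; rewrite tnth_mktuple.
  by move=> H i; rewrite tnth_mktuple; apply: H; rewrite /= inE.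
by apply: eq_big => [i|i _]; rewrite ?inE//; exact: xiX.
Qed.

Section chi_square.
Context {d} {T : measurableType d} {R : realType}.

(** Cauchy-Schwarz for [f] against the constant 1 on [A]. The integral of [f ^+ 2] is allowed to be
    infinite. *)
Lemma sqr_integral_le (mu : {finite_measure set T -> \bar R}) (A : set T)
    (f : T -> \bar R) : measurable A -> measurable_fun A f ->
  (forall x, 0 <= f x) -> (forall x, f x \is a fin_num) ->
  \int[mu]_(x in A) f x < +oo ->
  (\int[mu]_(x in A) f x) ^+ 2 <= \int[mu]_(x in A) (f x ^+ 2) * mu A.
Proof.
move=> mA mf f0 ffin foo.
have If0 : 0 <= \int[mu]_(x in A) f x by exact: integral_ge0.
have f2_ge0 x : 0 <= f x ^+ 2 by rewrite expe2 mule_ge0.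
have mf2 : measurable_fun A (fun x => f x ^+ 2).
  by under eq_fun do rewrite expe2; exact: emeasurable_funM.
have If2 : 0 <= \int[mu]_(x in A) (f x ^+ 2) by exact: integral_ge0.
(* Integrating [2 c f <= f^2 + c^2] over [A]; the best [c] is [b / a]. *)
have young (c : R) : (0 <= c)%R -> (2 * c)%:E * \int[mu]_(x in A) f x <=
    \int[mu]_(x in A) (f x ^+ 2) + (c ^+ 2)%:E * mu A.
  move=> c0.
  rewrite -ge0_integralZl//; last by rewrite lee_fin mulr_ge0.
  rewrite -integral_cst// -ge0_integralD//; last 1 first.
    by move=> x _; rewrite lee_fin sqr_ge0.
  apply: ge0_le_integral => //.
  - by move=> x _; rewrite mule_ge0// lee_fin mulr_ge0.
  - exact: measurable_funeM.
  - exact: emeasurable_funD.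
  - move=> x _; move: (ffin x); case: (f x) => // y _.
    rewrite expe2 -!EFinM -EFinD lee_fin.
    by have := sqr_ge0 (y - c)%R; rewrite !expr2; nra.
(* A null [A] is set apart because the choice [c = b / a] divides by [a = mu A]; both sides are then
   0. *)
have [A0|A0] := eqVneq (mu A) 0.
  rewrite (_ : \int[mu]_(x in A) f x = 0) ?A0 ?mule0 ?expe2 ?mul0e//.
  exact: null_set_integral.
have Apos : 0 < mu A by rewrite lt0e A0/=.
have Afin : mu A \is a fin_num by exact: fin_num_measure.
have Iffin : \int[mu]_(x in A) f x \is a fin_num by rewrite ge0_fin_numE.
move: young If2; case: (\int[mu]_(x in A) (f x ^+ 2)) => [s||//]; last first.
  by move=> _ _; rewrite gt0_mulye// leey.
rewrite -(fineK Iffin) -(fineK Afin) in If0 Apos *.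
move: (fine (integral _ _ _)) (fine (mu A)) If0 Apos => b a; rewrite lee_fin lte_fin => b0 a0.
move=> /(_ (b / a)%R); rewrite divr_ge0// ?(ltW a0)// => /(_ isT).
rewrite expe2 -!EFinM -EFinD !lee_fin => + _.
have -> : (2 * (b / a) * b = 2 * (b ^+ 2 / a))%R by ring.
have -> : ((b / a) ^+ 2 * a = b ^+ 2 / a)%R by field; rewrite gt_eqF.
move=> H; have : (b ^+ 2 / a <= s)%R by lra.
by rewrite ler_pdivrMr// expr2.
Qed.

Variables nu mu : probability T R.

(** The infinite and degenerate cases are removed first; what remains is algebra on the reals
    [a = mu A], [b = nu A] and the integrals [p], [q] of the squared density over [A] and its
    complement. *)
Lemma dominated_probability_dist_le (A : set T) : nu `<< mu -> measurable A ->
  `|nu A - mu A| <=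
  sqrte (\int[mu]_x (Radon_Nikodym_SigmaFinite.f nu mu x ^+ 2) - 1) *
  sqrte (mu A).
Proof.
move=> numu mA; set f := Radon_Nikodym_SigmaFinite.f nu mu.
have f0 x : 0 <= f x by exact: Radon_Nikodym_SigmaFinite.f_ge0.
have ffin x : f x \is a fin_num by exact: Radon_Nikodym_SigmaFinite.f_fin_num.
have mf : measurable_fun setT f.
  by apply: measurable_int; exact: Radon_Nikodym_SigmaFinite.f_integrable.
have mf2 : measurable_fun setT (fun x => f x ^+ 2).
  by under eq_fun do rewrite expe2; exact: emeasurable_funM.
have f2_ge0 x : 0 <= f x ^+ 2 by rewrite expe2 mule_ge0.
have CS B : measurable B ->
    (nu B) ^+ 2 <= \int[mu]_(x in B) (f x ^+ 2) * mu B.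
  move=> mB; have fB := Radon_Nikodym_SigmaFinite.f_integral numu mB.
  rewrite fB; apply: sqr_integral_le => //; first exact: measurable_funTS.
  by rewrite -fB ltey_eq fin_num_measure.
have mAC : measurable (~` A) by exact: measurableC.
have := CS _ mAC; have := CS _ mA.
rewrite !probability_setC//.
have -> : \int[mu]_x (f x ^+ 2) =
    \int[mu]_(x in A) (f x ^+ 2) + \int[mu]_(x in ~` A) (f x ^+ 2).
  rewrite -ge0_integral_setU ?setUv//.
  by apply/disj_setPS; rewrite setICr.
have [s0 t0] : 0 <= \int[mu]_(x in A) (f x ^+ 2) /\
    0 <= \int[mu]_(x in ~` A) (f x ^+ 2).
  by split; exact: integral_ge0.
move: s0 t0; set s := integral _ _ _; set t := integral _ _ _ => s0 t0.
have [A0|A0] := eqVneq (mu A) 0.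
  have -> : nu A = 0 by apply: (null_content_dominatesP nu mu).1 => //.
  by move=> _ _; rewrite A0 sube0 abse0 sqrte0 mule0.
have Apos : 0 < sqrte (mu A).
  rewrite -[ltLHS]sqrte0 ltNge lee_sqrt// -ltNge lt0e A0/=; exact: measure_ge0.
(* If the squared density has infinite integral, the right side is [+oo], since [sqrte (mu A)] is
   positive. *)
have [stfin|] := boolP (s + t \is a fin_num); last first.
  rewrite fin_numE negb_and !negbK => /orP[/eqP stNy|/eqP -> _ _].
    by have := adde_ge0 s0 t0; rewrite stNy.
  by rewrite /= gt0_mulye// leey.
move: stfin; rewrite fin_numD => /andP[sfin tfin].
have A1 := probability_le1 mu mA.
have nuAfin : nu A \is a fin_num by exact: fin_num_measure.
have muAfin : mu A \is a fin_num by exact: fin_num_measure.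
have muA0 : 0 <= mu A by [].
rewrite -(fineK sfin) -(fineK tfin) -(fineK nuAfin) in s0 t0 *.
rewrite -(fineK muAfin) in A1 muA0 *.
move: (fine s) (fine t) (fine (nu A)) (fine (mu A)) s0 t0 A1 muA0.
move=> p q b a; rewrite !lee_fin => p0 q0 a1 a0.
move=> pa qa.
(* This is [2 c (1 - b) <= q + c^2 (1 - a)] at [c = 1]. *)
have q_ge : (1 - 2 * b + a <= q)%R.
  (* For [a < 1], multiply by [1 - a] and use [(1 - 2b + a)(1 - a) = (1 - b)^2 - (b - a)^2]. For
     [a = 1], [qa] forces [b = 1]. *)
  move: a1; rewrite le_eqVlt => /predU1P[a1|a1]; last first.
    rewrite -(@ler_pM2r _ (1 - a)%R) ?subr_gt0//; apply: le_trans qa.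
    by have := sqr_ge0 (b - a)%R; rewrite expr2; lra.
  move: qa; rewrite a1 subrr mulr0 -expr2 => qa.
  have : (1 - b == 0)%R by rewrite -sqrf_eq0 eq_le qa sqr_ge0.
  by rewrite subr_eq0 => /eqP <-; lra.
(* It remains to see that [(b - a)^2 <= a (p + q - 1)]: add [pa] to [a] times [q_ge]. *)
rewrite mulrC -sqrtrM// -sqrtr_sqr ler_wsqrtr//.
by rewrite expr2; nra.
Qed.

End chi_square.

Theorem theorem7p3 (R : realType) (n : nat)
    (d d' : measure_display) (T : measurableType d) (T' : measurableType d')
    (P : probability T R) (P' : probability T' R)
    (X : 'I_n -> {RV P >-> R}) (xi : 'I_n -> {RV P' >-> R}) :
  joint_law X `<< product_of_marginals X ->
  mutually_independent xi ->
  (forall k : 'I_n, same_distribution (xi k) (X k)) ->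
  forall h : n.-tuple R -> R, measurable_fun [set: n.-tuple R] h ->
  forall x : R,
    `| P [set w | (h [tuple X i w | i < n] <= x)%R]
       - P' [set w | (h [tuple xi i w | i < n] <= x)%R] |
    <= pearson_coef X
       * maxe (sqrte (P' [set w | (h [tuple xi i w | i < n] <= x)%R]))
              (sqrte (P' [set w | (h [tuple xi i w | i < n] > x)%R])).
Proof.
move=> jointX indep xiX h mh x.
pose A : set (n.-tuple R) := [set t | (h t <= x)%R].
have mA : measurable A.
  rewrite -[A]setTI (_ : A = h @^-1` `]-oo, x]); first exact: mh.
  by apply/seteqP; split=> t /=; rewrite in_itv.
have AE : P' [set w | (h [tuple xi i w | i < n] <= x)%R] =
    product_of_marginals X A.
  by rewrite -(joint_law_independent indep xiX).
have := dominated_probability_dist_le _ _ _ jointX mA.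
rewrite -AE => /le_trans; apply.
apply: lee_wpmul2l; first exact: sqrte_ge0.
(* The bound already holds with the first member of the maximum. *)
by rewrite le_max lexx.
Qed.
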